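(* Let $\phi_1,\dots,\phi_N:X\to\mathbb R$ be continuous and assume that $$\mu\left(\{x\in X:\ \phi_i(x)-\phi_j(x)=r\}\right)=0\quad\text{for all } i\neq j \text{ in } I \text{ and all } r\in\mathbb R,$$ $$\mu\left(\{x\in X:\ \phi_i(x)=r\}\right)=0\quad\text{for all } i\in I \text{ and all } r\in\mathbb R .$$ Then for every $$\vec m\in\underline S^0_I:=\left\{\vec m\in\mathbb R^N:\ m_i\ge0\ \text{for all } i\in I,\ \ \sum_{i\in I}m_i<1\right\}$$ there is a unique optimal subpartition for the Monge partition problem, i.e. a unique $\vec\mu\in\underline{\mathcal P}^{w}_{\vec m}$ maximizing $\sum_{i=1}^N\int_X\phi_i\,d\mu_i$ over $\underline{\mathcal P}^{w}_{\vec m}$, and this subpartition is a strong one.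
   Context: $X$ is a compact Polish space with Borel $\sigma$-algebra $\mathcal B$, $\mu$ is a non-atomic Borel probability measure on $X$, and $I=\{1,\dots,N\}$. For $\vec m\in\mathbb R^N$, $\underline{\mathcal P}^{w}_{\vec m}$ (weak subpartitions in the Monge case, where all price functions are $\equiv1$) is the set of $N$-tuples $\vec\mu=(\mu_1,\dots,\mu_N)$ of non-negative Borel measures on $X$ with $\sum_i\mu_i\le\mu$ and $\mu_i(X)=m_i$ for all $i\in I$. Such a $\vec\mu$ is called strong if there are sets $X_1,\dots,X_N\in\mathcal B$ with $\mu(X_i\cap X_j)=0$ for $i\ne j$, $\mu(X_i)=m_i$, and $\mu_i=\mu\lfloor X_i$ (restriction of $\mu$ to $X_i$) for all $i$. *)

(* Defs.v *)
From HB Require Import structures.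
From mathcomp Require Import all_boot all_order all_algebra.
From mathcomp Require Import all_classical all_reals all_analysis.

Set Implicit Arguments.
Unset Strict Implicit.
Unset Printing Implicit Defensive.

Import Order.TTheory GRing.Theory Num.Theory.
Import numFieldNormedType.Exports.

Local Open Scope classical_set_scope.
Local Open Scope ring_scope.

Definition separable (T : topologicalType) : Prop :=
  exists2 D : set T, countable D & dense D.

Definition homeomorphic (S T : topologicalType) : Prop :=
  exists (f : S -> T) (g : T -> S),
    [/\ continuous f, continuous g, cancel f g & cancel g f].

Definition completely_metrizable (R : realType) (T : topologicalType) : Prop :=
  exists M : metricType R, homeomorphic T M /\
    forall F : set_system M, ProperFilter F -> cauchy F ->
      exists l : M, F --> l.

Definition polish (R : realType) (T : topologicalType) : Prop :=
  separable T /\ completely_metrizable R T.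

Notation borel X := (g_sigma_algebraType (@open X)).

Definition nonatomic d (T : measurableType d) (R : realType)
    (mu : {measure set T -> \bar R}) : Prop :=
  forall A : set T, measurable A -> (0 < mu A)%E ->
    exists B : set T,
      [/\ measurable B, B `<=` A, (0 < mu B)%E & (mu B < mu A)%E].

Section subpartitions.
Context d (T : measurableType d) (R : realType) (N : nat).
Variable mu : {measure set T -> \bar R}.
Implicit Types (m : 'I_N -> R) (phi : 'I_N -> T -> R).
Implicit Types nu : 'I_N -> {measure set T -> \bar R}.

Definition weak_subpartition m nu : Prop :=
  (forall A, measurable A -> (\sum_(i < N) nu i A <= mu A)%E) /\
  (forall i, nu i [set: T] = (m i)%:E).

Definition strong_subpartition m nu : Prop :=
  exists (P : 'I_N -> set T) (mP : forall i, measurable (P i)),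
    [/\ forall i j, i != j -> mu (P i `&` P j) = 0%E,
        forall i, mu (P i) = (m i)%:E
      & forall i A, measurable A -> nu i A = mrestr mu (mP i) A].

Definition total_profit phi nu : \bar R :=
  (\sum_(i < N) \int[nu i]_x (phi i x)%:E)%E.

Definition optimal_subpartition phi m nu : Prop :=
  weak_subpartition m nu /\
  forall nu', weak_subpartition m nu' ->
    (total_profit phi nu' <= total_profit phi nu)%E.

End subpartitions.

(* A measure of the library is a function on all subsets, whose values on
   non-measurable ones are junk; hence equality on measurable sets only. *)
Definition eq_measures d (T : measurableType d) (R : realType) (N : nat)
    (nu nu' : 'I_N -> {measure set T -> \bar R}) : Prop :=
  forall i A, measurable A -> nu i A = nu' i A.

(* Main.v *)
Require Import Defs.
From HB Require Import structures.
From mathcomp Require Import all_boot all_order all_algebra.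
From mathcomp Require Import all_classical all_reals all_analysis.
From mathcomp Require Import measurable_realfun lra.

(** Think of the points of the space as buyers and of the indices as goods:
good [i] is worth [phi i x] to buyer [x] and is in supply [m i]. At prices [p]
a buyer gets the surplus [u x = max (0, max_i (phi i x - p i))], and the cell
of [i] is the set of the buyers for whom good [i] attains it. The theorem
follows from two facts.

Market clearing ([market_clearing]): some prices give every cell [i] the mass
[m i]. Call [p] underdemanded if every cell has mass at most [m i]. High prices
are underdemanded. An underdemanded [p] is bounded below: if a price were so
low that everybody bought, the cells would cover the space, and their total
mass would be 1, more than the sum of the [m i]. Let [p0] be the coordinatewise
infimum of the underdemanded prices. Goods are substitutes, that is, a cell
grows when its own price falls or another price rises, and the mass of a cell
depends continuously on its own price because the ties [phi i - phi j = r] and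
[phi i = r] are null. Hence [p0] is itself underdemanded, and no cell can have
mass below [m i] at [p0], as its price could then be lowered a little more.

Duality ([total_profit_add_regret_le]): let the regret of index [i] at [x] be
[u x - (phi i x - p i)], which is nonnegative and vanishes exactly on cell [i].
Since the [nu i] add up to at most [mu], the profit of a weak subpartition plus
its total regret is at most [\int u dmu + \sum_i p i * m i], and the
restrictions of [mu] to the cells attain this bound with zero regret. They are
thus optimal. Any other optimum also has zero regret, so each [nu i] is
concentrated on cell [i]; being dominated by [mu] with the mass of [mu] on that
cell, it is the restriction of [mu] to it ([eq_mrestr_concentrated]). *)

Set Implicit Arguments.
Unset Strict Implicit.
Unset Printing Implicit Defensive.

Import Order.TTheory GRing.Theory Num.Theory.
Import numFieldNormedType.Exports.

Local Open Scope classical_set_scope.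
Local Open Scope ring_scope.

(** * Superlevel sets and finite families of sets *)

Lemma measurable_level d (T : measurableType d) (R : realType) (f : T -> R)
    (t : R) :
  measurable_fun [set: T] f -> measurable [set x | f x = t].
Proof.
move=> mf; rewrite -[X in measurable X]setTI.
exact: (mf measurableT _ (measurable_set1 t)).
Qed.

Section distribution_function.
Context d (T : measurableType d) (R : realType).
Variables (mu : {finite_measure set T -> \bar R}) (g : T -> R).
Hypothesis mg : measurable_fun [set: T] g.

Let measurable_superlevel t : measurable [set x | t <= g x].
Proof.
by rewrite -[X in measurable X]setTI; apply: measurable_fun_le.
Qed.

(** Right-continuity of [t |-> mu (t <= g)] at a null level: the sets
[t + 1 / n <= g] increase to [t < g], which misses only the level set. *)
Lemma measure_superlevel_le (t : R) (a : \bar R) :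
  mu [set x | g x = t] = 0%E ->
  (forall e, 0 < e -> (mu [set x | (t + e <= g x)%R] <= a)%E) ->
  (mu [set x | (t <= g x)%R] <= a)%E.
Proof.
move=> g0 ga.
pose F (n : nat) := [set x | t + n.+1%:R^-1 <= g x].
have mF n : measurable (F n) by exact: measurable_superlevel.
have mbF : measurable (\bigcup_n F n) by exact: bigcup_measurable.
have mt : measurable [set x | g x = t].
  exact: measurable_level.
have ndF : {homo F : n k / (n <= k)%N >-> (n <= k)%O}.
  move=> n k nk; apply/subsetPset => x; apply: le_trans.
  by rewrite lerD2l lef_pV2 ?posrE// ler_nat.
have : (mu (\bigcup_n F n) <= a)%E.
  apply: cvge_le (nondecreasing_cvg_mu mF mbF ndF).
  by near=> n; apply: ga; rewrite invr_gt0.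
apply: le_trans; rewrite -(measureU0 mbF mt g0).
apply: le_measure; rewrite ?inE//; first exact: measurableU.
move=> x /=; rewrite le_eqVlt => /predU1P[->|tx]; first by right.
left; have [n ntx] := @ltr_add_invr R _ _ tx.
by exists n => //; exact: ltW.
Unshelve. all: by end_near. Qed.

(** Left-continuity of [t |-> mu (t <= g)]: the sets [t - 1 / n <= g] have
finite measure and decrease to [t <= g]. *)
Lemma measure_superlevel_lt (t : R) (a : \bar R) :
  (mu [set x | (t <= g x)%R] < a)%E ->
  exists2 e, 0 < e & (mu [set x | (t - e <= g x)%R] < a)%E.
Proof.
move=> ga.
pose F (n : nat) := [set x | t - n.+1%:R^-1 <= g x].
have mF n : measurable (F n) by exact: measurable_superlevel.
have FE : \bigcap_n F n = [set x | t <= g x].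
  apply/seteqP; split=> [x Fx|x /= tx n _]; last first.
    by rewrite /F/= lerBlDr (le_trans tx)// lerDl invr_ge0.
  rewrite /= leNgt; apply/negP => /ltr_add_invr[n].
  by apply/negP; rewrite -leNgt -lerBlDr; exact: Fx.
have niF : {homo F : n k / (n <= k)%N >-> (k <= n)%O}.
  move=> n k nk; apply/subsetPset => x; apply: le_trans.
  by rewrite lerD2l lerN2 lef_pV2 ?posrE// ler_nat.
apply: contrapT => nex.
have F0y : (mu (F 0%N) < +oo)%E by rewrite ltey_eq fin_num_measure.
have mbF : measurable (\bigcap_n F n) by rewrite FE.
have: (a <= mu (\bigcap_n F n))%E.
  apply: cvge_to_ge (nonincreasing_cvg_mu F0y mF mbF niF) _.
  near=> n; rewrite leNgt; apply/negP => ltFa; apply: nex.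
  by exists n.+1%:R^-1; rewrite ?invr_gt0.
by rewrite FE leNgt ga.
Unshelve. all: by end_near. Qed.

End distribution_function.

Section finite_families.
Context d (T : measurableType d) (R : realType).
Variable mu : {measure set T -> \bar R}.

Lemma le_measure_bigsetU (I : finType) (F : I -> set T) :
  (forall i, measurable (F i)) ->
  (mu (\big[setU/set0]_i F i) <= \sum_i mu (F i))%E.
Proof.
move=> mF.
suff [] : measurable (\big[setU/set0]_i F i) /\
    (mu (\big[setU/set0]_i F i) <= \sum_i mu (F i))%E by [].
elim/big_ind2 : _ => //; first by rewrite measure0.
move=> A a B b [mA Aa] [mB Bb]; split; first exact: measurableU.
by apply: le_trans (measureU2 _ mA mB) _; exact: leeD.
Qed.

Lemma negligible_bigsetU_fin (I : finType) (P : pred I) (F : I -> set T) :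
  (forall i, P i -> mu.-negligible (F i)) ->
  mu.-negligible (\big[setU/set0]_(i | P i) F i).
Proof.
move=> F0; elim/big_ind : _ => //; first exact: negligible_set0.
exact: negligibleU.
Qed.

(** Removing from each [F i] its null overlaps with the others makes the
family disjoint without changing any of the measures. *)
Lemma sum_measure_ae_disjoint (n : nat) (F : 'I_n -> set T) (A : set T) :
  (forall i, measurable (F i)) ->
  (forall i j, i != j -> mu (F i `&` F j) = 0%E) -> measurable A ->
  (\sum_(i < n) mu (A `&` F i) <= mu A)%E.
Proof.
move=> mF F0 mA.
pose G i := \big[setU/set0]_(j | j != i) (F i `&` F j).
have mG i : measurable (G i).
  by apply: bigsetU_measurable => j _; exact: measurableI.
have G0 i : mu (G i) = 0%E.
  apply: measure_negligible => //; apply: negligible_bigsetU_fin => j ji.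
  apply/negligibleP; first exact: measurableI. by apply: F0; rewrite eq_sym.
pose D i := A `&` F i `\` G i.
have mD i : measurable (D i) by apply: measurableD => //; exact: measurableI.
have DE i : mu (A `&` F i) = mu (D i).
  apply/eqP; rewrite eq_le; apply/andP; split; last first.
    by apply: le_measure; rewrite ?inE//; [exact: measurableI|exact: subDsetl].
  rewrite -(measureU0 (mD i) (mG i) (G0 i)); apply: le_measure; rewrite ?inE//.
  - exact: measurableI.
  - exact: measurableU.
  - by move=> x AFx; have [|] := pselect (G i x); [right|left; split].
rewrite (eq_bigr _ (fun i _ => DE i)) -measure_bigsetU_ord//.
  apply: le_measure; rewrite ?inE//; first exact: bigsetU_measurable.
  elim/big_ind : _ => [//|B C BA CA|i _ x [[]]//].
  by rewrite subUset; split.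
apply/trivIsetP => i j _ _ ij; apply/seteqP; split=> // x [] [[_ Fi] nG] [[_ Fj] _].
apply: nG; rewrite /G (bigD1 j) 1?eq_sym//=; left; split => //.
Qed.

End finite_families.

(** * Prices, surplus and cells *)

Section cells.
Context (T : Type) (R : realType) (N : nat).
Implicit Types (phi : 'I_N -> T -> R) (p q : 'I_N -> R).

Definition surplus phi p (x : T) : R := \big[Num.max/0]_j (phi j x - p j).

(** The best option other than [i]. It does not depend on [p i], so that cell
[i], as a function of [p i] alone, is a superlevel set of [phi i - rival]. *)
Definition rival phi p i (x : T) : R :=
  \big[Num.max/0]_(j | j != i) (phi j x - p j).

(** As the surplus dominates every [phi i x - p i], the inequality says that
[i] attains it; a point where several goods are tied is in several cells. *)
Definition cell phi p i : set T := [set x | surplus phi p x <= phi i x - p i].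

Definition set_price p i (t : R) : 'I_N -> R :=
  fun j => if j == i then t else p j.

Lemma surplus_ge0 phi p x : 0 <= surplus phi p x.
Proof. exact: bigmax_ge_id. Qed.

Lemma surplus_ge phi p i x : phi i x - p i <= surplus phi p x.
Proof. exact: (le_bigmax _ (fun j => phi j x - p j)). Qed.

Lemma cellP phi p i x :
  cell phi p i x <->
  0 <= phi i x - p i /\ forall j, phi j x - p j <= phi i x - p i.
Proof.
rewrite /cell /surplus /=; split=> [/bigmax_leP[? H]|[? H]].
  by split=> // j; exact: H.
by apply/bigmax_leP; split=> // j _; exact: H.
Qed.

Lemma cell_surplusE phi p i x : cell phi p i x -> surplus phi p x = phi i x - p i.
Proof. by move=> pix; apply/eqP; rewrite eq_le pix surplus_ge. Qed.

Lemma surplus_attained phi p x :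
  surplus phi p x = 0 \/ exists i, cell phi p i x.
Proof.
suff [|[i Hi]] : surplus phi p x = 0 \/
    exists i, surplus phi p x = phi i x - p i; [by left| |].
  by right; exists i; rewrite /cell /= Hi.
rewrite /surplus; elim/big_ind : _ => [|a b Ha Hb|i _]; [by left| |].
  by case: leP.
by right; exists i.
Qed.

Lemma cell_set_price phi p i t :
  cell phi (set_price p i t) i = [set x | t <= phi i x - rival phi p i x].
Proof.
rewrite /cell /surplus /set_price; apply/seteqP.
have E x : (t <= phi i x - rival phi p i x) = (rival phi p i x <= phi i x - t).
  by rewrite lerBrDr addrC -lerBrDr.
split=> x /=; rewrite E eqxx => /bigmax_leP[ge0 H]; apply/bigmax_leP; split=> //.
- by move=> j /negPf ji; have := H j isT; rewrite ji.
- by move=> j _; case: ifPn => [/eqP->//|ji]; exact: H.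
Qed.

Lemma set_price_id p i : set_price p i (p i) = p.
Proof. by apply/funext => j; rewrite /set_price; case: eqP => [->|]. Qed.

(** Gross substitutes: the demand for [i] grows when [i] gets cheaper and the
other goods dearer. *)
Lemma sub_cell phi p q i :
  q i <= p i -> (forall j, j != i -> p j <= q j) ->
  cell phi p i `<=` cell phi q i.
Proof.
move=> qpi pq x /cellP[ge0 H]; apply/cellP.
have qp : phi i x - p i <= phi i x - q i by rewrite lerD2l lerN2.
split=> [|j]; first exact: le_trans qp.
have [->//|ji] := eqVneq j i.
by apply: le_trans (le_trans (H j) qp); rewrite lerD2l lerN2 pq.
Qed.

End cells.

Section measurable_cells.
Context d (T : measurableType d) (R : realType) (N : nat).
Variables (phi : 'I_N -> T -> R).
Hypothesis mphi : forall i, measurable_fun [set: T] (phi i).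
Implicit Types p : 'I_N -> R.

Let measurable_bigmax p (P : pred 'I_N) :
  measurable_fun [set: T] (fun x => \big[Num.max/0]_(j | P j) (phi j x - p j)).
Proof.
elim: (index_enum _) => [|j s IH].
  by under eq_fun do rewrite big_nil; exact: measurable_cst.
case Pj : (P j); under eq_fun do rewrite big_cons Pj; last exact: IH.
by apply: measurable_maxr => //; apply: measurable_funB.
Qed.

Lemma measurable_surplus p : measurable_fun [set: T] (surplus phi p).
Proof. exact: measurable_bigmax. Qed.

Lemma measurable_rival p i : measurable_fun [set: T] (rival phi p i).
Proof. exact: measurable_bigmax. Qed.

Lemma measurable_cell p i : measurable (cell phi p i).
Proof.
rewrite -[cell _ _ _]setTI; apply: measurable_fun_le => //.
  exact: measurable_surplus.
by apply: measurable_funB.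
Qed.

Lemma measurable_surplus0 p : measurable [set x | surplus phi p x = 0].
Proof.
by apply: measurable_level; exact: measurable_surplus.
Qed.

(** At each point the surplus is 0 or is attained by some good, so the cells and
the zero set of the surplus cover the space. *)
Lemma le_measure_cells (mu : {measure set T -> \bar R}) p A : measurable A ->
  (mu A <= \sum_i mu (A `&` cell phi p i)
           + mu (A `&` [set x | surplus phi p x = 0%R]))%E.
Proof.
move=> mA.
have mAc i : measurable (A `&` cell phi p i).
  by apply: measurableI => //; exact: measurable_cell.
have mA0 : measurable (A `&` [set x | surplus phi p x = 0]).
  by apply: measurableI => //; exact: measurable_surplus0.
have mU : measurable (\big[setU/set0]_i (A `&` cell phi p i)).
  exact: bigsetU_measurable.
apply: (@le_trans _ _ (mu (\big[setU/set0]_i (A `&` cell phi p i) `|`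
    A `&` [set x | surplus phi p x = 0]))).
  apply: le_measure; rewrite ?inE//; first exact: measurableU.
  move=> x Ax; have [x0|[i xi]] := surplus_attained phi p x; first by right.
  by left; rewrite (bigD1 i)//=; left.
by apply: le_trans (measureU2 _ mU mA0) _; rewrite leeD2r// le_measure_bigsetU.
Qed.

End measurable_cells.

(** * Market-clearing prices *)

Section market_clearing.
Context d (T : measurableType d) (R : realType) (N : nat).
Variables (mu : probability T R) (phi : 'I_N -> T -> R).
Hypothesis mphi : forall i, measurable_fun [set: T] (phi i).
Hypothesis diff_null : forall i j, i != j -> forall r : R,
  mu [set x | phi i x - phi j x = r] = 0%E.
Hypothesis level_null : forall i (r : R), mu [set x | phi i x = r] = 0%E.

Let measurable_diff i j r : measurable [set x | phi i x - phi j x = r].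
Proof.
by apply: measurable_level; exact: measurable_funB.
Qed.

(** Both goods attain the surplus on the overlap, which fixes
[phi i - phi j]. *)
Lemma measure_cellI p i j : i != j ->
  mu (cell phi p i `&` cell phi p j) = 0%E.
Proof.
move=> ij; apply: measure_negligible.
  by apply: measurableI; exact: measurable_cell.
apply: (@negligibleS _ _ _ _ [set x | phi i x - phi j x = p i - p j]).
  move=> x [xi xj] /=; have := cell_surplusE xj.
  by rewrite (cell_surplusE xi); lra.
by apply/negligibleP => //; exact: diff_null.
Qed.

(** The rival is, at each point, 0 or one of the [phi j - p j], so the
level set lies in finitely many ties; it follows that the mass of cell [i] is
continuous in [p i]. *)
Lemma measure_net_level p i t :
  mu [set x | phi i x - rival phi p i x = t] = 0%E.
Proof.
apply: measure_negligible.
  apply: measurable_level; apply: measurable_funB => //.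
  exact: measurable_rival.
apply: (@negligibleS _ _ _ _ ([set x | phi i x = t] `|`
  \big[setU/set0]_(j | j != i) [set x | phi i x - phi j x = t - p j])).
  move=> x /=; have [->|[j ji ->]] : rival phi p i x = 0 \/
      exists2 j, j != i & rival phi p i x = phi j x - p j.
  - rewrite /rival; elim/big_ind : _ => [|a b Ha Hb|j ji]; first by left.
      by case: leP.
    by right; exists j.
  - by rewrite subr0; left.
  - rewrite opprB addrCA => e; right; rewrite (bigD1 j)//=; left => /=.
    by rewrite -e addrAC subrr add0r.
apply: negligibleU.
  by apply/negligibleP; [exact: measurable_level|exact: level_null].
apply: negligible_bigsetU_fin => j ji.
by apply/negligibleP => //; apply: diff_null; rewrite eq_sym.
Qed.

Variables (M : R) (m : 'I_N -> R).
Hypothesis phiM : forall i x, `|phi i x| <= M.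
Hypothesis m0 : forall i, 0 <= m i.
Hypothesis m1 : \sum_i m i < 1.

Let underdemand : set ('I_N -> R) :=
  [set p | forall i, (mu (cell phi p i) <= (m i)%:E)%E].

(** At prices above the upper bound of all the [phi i], nobody buys. *)
Let underdemand_nonempty : underdemand (cst (M + 1)).
Proof.
move=> i; rewrite (_ : cell _ _ _ = set0) ?measure0 ?lee_fin//.
apply/seteqP; split=> // x /cellP[+ _]; apply/negP; rewrite -ltNge /cst.
by rewrite subr_lt0 (le_lt_trans (ler_norm _))// ltr_pwDr.
Qed.

(** A price below the lower bound of the [phi i] leaves every point with a
positive surplus; then the cells cover the space and have total mass at least
1. *)
Let underdemand_ge p : underdemand p -> forall k, - M <= p k.
Proof.
move=> pS k; rewrite leNgt; apply/negP => pkM.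
have sgt0 x : surplus phi p x <> 0.
  apply/eqP; rewrite gt_eqF// (lt_le_trans _ (surplus_ge phi p k x))//.
  rewrite subr_gt0 (lt_le_trans pkM)// lerNl (le_trans _ (phiM k x))//.
  by rewrite -normrN ler_norm.
have := le_measure_cells mphi mu p measurableT.
rewrite setTI (_ : [set x | _] = set0); last by apply/seteqP; split.
rewrite measure0 adde0 => le1.
have /eqP := probability_setT mu; apply/negP; rewrite lt_eqF//.
apply: le_lt_trans le1 _; apply: (@le_lt_trans _ _ (\sum_i m i)%:E) => //.
by rewrite -sumEFin; apply: lee_sum => i _; rewrite setTI; exact: pS.
Qed.

Let p0 : 'I_N -> R := fun i => inf [set p i | p in underdemand].

Let has_inf_underdemand i : has_inf [set p i | p in underdemand].
Proof.
split; first by exists (M + 1), (cst (M + 1)).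
by exists (- M) => _ [p pS <-]; exact: underdemand_ge.
Qed.

Let p0_le p i : underdemand p -> p0 i <= p i.
Proof.
by move=> pS; apply: ge_inf; [exact: (has_inf_underdemand i).2|exists p].
Qed.

(** Raise the price of [i] from [p0 i] by [e]: some underdemanded [p] is below
this price at [i] and is above [p0] elsewhere, so its cell [i] contains the one
considered. Then let [e] tend to 0. *)
Let underdemand_p0 : underdemand p0.
Proof.
move=> i; rewrite -(set_price_id p0 i) cell_set_price.
apply: measure_superlevel_le.
- by apply: measurable_funB => //; exact: measurable_rival.
- exact: measure_net_level.
move=> e e0; rewrite -cell_set_price.
have [_ [p pS <-] pe] := inf_adherent e0 (has_inf_underdemand i).
apply: le_trans (pS i); apply: le_measure; rewrite ?inE; try exact: measurable_cell.
apply: sub_cell => [|j ji]; first by rewrite /set_price eqxx ltW.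
by rewrite /set_price (negPf ji) p0_le.
Qed.

Lemma market_clearing : exists p, forall i, mu (cell phi p i) = (m i)%:E.
Proof.
exists p0 => i; apply/eqP; rewrite eq_le underdemand_p0 /= leNgt; apply/negP.
rewrite -{1}(set_price_id p0 i) cell_set_price => /measure_superlevel_lt[].
  by apply: measurable_funB => //; exact: measurable_rival.
move=> e e0; rewrite -cell_set_price => lt_m.
(* The lowered price vector stays underdemanded, against the infimum. *)
suff /(@p0_le _ i) : underdemand (set_price p0 i (p0 i - e)).
  by rewrite /set_price eqxx leNgt ltrBlDr ltrDl e0.
move=> j; have [->|ji] := eqVneq j i; first exact: ltW.
apply: le_trans (underdemand_p0 j).
apply: le_measure; rewrite ?inE; try exact: measurable_cell.
apply: sub_cell => [|k _]; first by rewrite /set_price (negPf ji).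
by rewrite /set_price; case: eqP => [->|//]; rewrite lerBlDr lerDl ltW.
Qed.

End market_clearing.

(** * Integrals against dominated and concentrated measures *)

Section integration.
Context d (T : measurableType d) (R : realType).
Implicit Types (nu mu : {measure set T -> \bar R}) (f : T -> R).

Lemma bounded_integrable nu f (M : R) : (nu [set: T] < +oo)%E ->
  measurable_fun [set: T] f -> (forall x, `|f x| <= M) ->
  nu.-integrable [set: T] (EFin \o f).
Proof.
move=> nuy mf fM; apply: measurable_bounded_integrable => //.
exists M; split; first exact: num_real.
by move=> y /ltW My x _; exact: le_trans (fM x) My.
Qed.

Lemma integral_eq0_concentrated nu f (C : set T) : measurable C ->
  measurable_fun [set: T] f -> (forall x, 0 <= f x) ->
  (forall x, C x -> f x = 0) -> nu (~` C) = 0%E ->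
  (\int[nu]_x (f x)%:E = 0)%E.
Proof.
move=> mC mf f0 fC nuC.
have mf' : measurable_fun [set: T] (EFin \o f) by exact/measurable_EFinP.
rewrite (ge0_negligible_integral (measurableC mC) measurableT mf' _ nuC).
  by rewrite setDE setCK setTI; apply: integral0_eq => x Cx; rewrite /= fC.
by move=> x _; rewrite /= lee_fin.
Qed.

Lemma concentrated_integral_eq0 nu f (C : set T) : measurable C ->
  measurable_fun [set: T] f -> (forall x, 0 <= f x) ->
  (forall x, ~ C x -> 0 < f x) -> (\int[nu]_x (f x)%:E = 0)%E ->
  nu (~` C) = 0%E.
Proof.
move=> mC mf f0 fC If.
have mf' : measurable_fun [set: T] (EFin \o f) by exact/measurable_EFinP.
have /(ae_eq_integral_abs nu measurableT mf') : (\int[nu]_x `|(f x)%:E| = 0)%E.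
  by rewrite -[RHS]If; apply: eq_integral => x _; rewrite gee0_abs ?lee_fin.
move=> f_ae0; apply: measure_negligible; first exact: measurableC.
apply: negligibleS f_ae0 => x /fC fx /= /(_ I) [fx0].
by rewrite fx0 ltxx in fx.
Qed.

(** Both [nu A <= mu (A `&` C)] and the same inequality for the complement of
[A] hold, and the two sum up to an equality of finite numbers. *)
Lemma eq_mrestr_concentrated mu nu (C : set T) : measurable C ->
  (forall A, measurable A -> (nu A <= mu A)%E) -> nu (~` C) = 0%E ->
  nu [set: T] = mu C -> (nu [set: T] < +oo)%E ->
  forall A, measurable A -> nu A = mu (A `&` C).
Proof.
move=> mC numu nuC nuT nuy.
have nuI A : measurable A -> (nu A <= mu (A `&` C))%E.
  move=> mA; rewrite (measureDI nu mA mC) [X in (X + _)%E](_ : _ = 0%E) ?add0e.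
    by apply: numu; exact: measurableI.
  apply: (subset_measure0 (measurableD mA mC) (measurableC mC) _ nuC).
  by move=> x [].
move=> A mA; apply/eqP; rewrite eq_le nuI //= leNgt; apply/negP => lt.
have mA' : measurable (~` A) by exact: measurableC.
have : (nu [set: T] < mu C)%E.
  rewrite (measureDI mu mC mA) setDE addeC.
  rewrite (measureDI nu measurableT mA) setTD setTI [ltLHS]addeC.
  apply: lte_leD.
  - rewrite ge0_fin_numE//; apply: le_lt_trans nuy.
    by apply: le_measure; rewrite ?inE.
  - by rewrite setIC.
  - by rewrite setIC; exact: nuI.
by rewrite nuT ltxx.
Qed.

(** Padding by the zero measure turns a finite family into a sequence, whose
finite sums [msum] are measures. *)
Definition extend_family n (nu : 'I_n -> {measure set T -> \bar R})
    (k : nat) : {measure set T -> \bar R} :=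
  if insub k is Some i then nu i else mzero.

Lemma extend_familyE n (nu : 'I_n -> {measure set T -> \bar R}) (i : 'I_n) :
  extend_family nu i = nu i.
Proof. by rewrite /extend_family valK. Qed.

Lemma msum_extend_family n (nu : 'I_n -> {measure set T -> \bar R}) A :
  msum (extend_family nu) n A = (\sum_(i < n) nu i A)%E.
Proof. by rewrite /msum; apply: eq_bigr => i _; rewrite extend_familyE. Qed.

Lemma integral_msum_extend_family n (nu : 'I_n -> {measure set T -> \bar R}) f :
  measurable_fun [set: T] f -> (forall x, 0 <= f x) ->
  (\int[msum (extend_family nu) n]_x (f x)%:E
   = \sum_(i < n) \int[nu i]_x (f x)%:E)%E.
Proof.
move=> mf f0; rewrite ge0_integral_measure_sum//.
- by apply: eq_bigr => i _; rewrite extend_familyE.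
- by move=> x _; rewrite lee_fin.
- exact/measurable_EFinP.
Qed.

End integration.

(** * Optimality and uniqueness by duality *)

Section duality.
Context d (T : measurableType d) (R : realType) (N : nat).
Variables (mu : probability T R) (phi : 'I_N -> T -> R) (m p : 'I_N -> R).
Hypothesis mphi : forall i, measurable_fun [set: T] (phi i).
Variable M : R.
Hypothesis phiM : forall i x, `|phi i x| <= M.
Hypothesis cell_disjoint :
  forall i j, i != j -> mu (cell phi p i `&` cell phi p j) = 0%E.
Hypothesis cell_mass : forall i, mu (cell phi p i) = (m i)%:E.

Implicit Types nu : 'I_N -> {measure set T -> \bar R}.

Local Notation u := (surplus phi p).
Local Notation regret i x := (surplus phi p x - (phi i x - p i)).

Let mcell i : measurable (cell phi p i) := measurable_cell mphi p i.

Let mu_surplus : measurable_fun [set: T] u := measurable_surplus mphi p.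

Let regret_ge0 i x : 0 <= regret i x.
Proof. by rewrite subr_ge0 surplus_ge. Qed.

Let measurable_regret i : measurable_fun [set: T] (fun x => regret i x).
Proof. by apply: measurable_funB => //; exact: measurable_funB. Qed.

Let surplus_le x : `|u x| <= \big[Num.max/0]_j (M - p j).
Proof.
rewrite ger0_norm ?surplus_ge0//; apply: le_bigmax2 => j _.
by rewrite lerD2r (le_trans (ler_norm _)).
Qed.

(** Pointwise, profit plus regret is surplus plus price. Boundedness makes
all the integrals finite, which allows regret to be cancelled later. *)
Lemma profit_add_regret (nu : {measure set T -> \bar R}) i c :
  nu [set: T] = c%:E ->
  (\int[nu]_x (phi i x)%:E)%E \is a fin_num /\
  (\int[nu]_x (phi i x)%:E + \int[nu]_x (regret i x)%:E
   = \int[nu]_x (u x)%:E + (p i * c)%:E)%E.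
Proof.
move=> nuc; have nuy : (nu [set: T] < +oo)%E by rewrite nuc ltry.
have iphi := bounded_integrable nuy (mphi i) (phiM i).
have iu := bounded_integrable nuy mu_surplus surplus_le.
have ip : nu.-integrable [set: T] (EFin \o cst (p i)).
  by apply: (bounded_integrable nuy (M := `|p i|)); first exact: measurable_cst.
have ir : nu.-integrable [set: T] (fun x => (regret i x)%:E).
  have ipsi : nu.-integrable [set: T] (fun x => (phi i x - p i)%:E).
    exact: (integrableB measurableT iphi ip).
  exact: (integrableB measurableT iu ipsi).
split; first exact: integrable_fin_num.
rewrite -(integralD measurableT iphi ir).
transitivity (\int[nu]_x ((u x)%:E + (cst (p i) x)%:E))%E.
  by apply: eq_integral => x _; rewrite -!EFinD; congr (_%:E); rewrite /=; lra.
rewrite (integralD measurableT iu ip); congr (_ + _)%E.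
by rewrite EFinM -nuc; exact: (integral_cst nu measurableT (p i)%:E).
Qed.

Lemma sum_integral_surplus_le nu : weak_subpartition mu m nu ->
  (\sum_i \int[nu i]_x (u x)%:E <= \int[mu]_x (u x)%:E)%E.
Proof.
move=> [numu _]; rewrite -integral_msum_extend_family//; last exact: surplus_ge0.
apply: ge0_le_measure_integral => //.
- by move=> A mA; apply: le_trans (numu A mA); rewrite -msum_extend_family.
- by move=> x; rewrite lee_fin surplus_ge0.
- exact/measurable_EFinP.
Qed.

Let nu0 i : {measure set T -> \bar R} := mrestr mu (mcell i).

Lemma weak_subpartition_cells : weak_subpartition mu m nu0.
Proof.
split=> [A mA|i]; last by rewrite /nu0 /= /mrestr setTI.
exact: sum_measure_ae_disjoint.
Qed.

Lemma strong_subpartition_cells : strong_subpartition mu m nu0.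
Proof. by exists (cell phi p), mcell; split. Qed.

Let nu0_regret i : (\int[nu0 i]_x (regret i x)%:E = 0)%E.
Proof.
apply: (integral_eq0_concentrated (mcell i)) => //.
- by move=> x xi; rewrite (cell_surplusE xi) subrr.
- by rewrite /nu0 /= /mrestr setICl measure0.
Qed.

(** The cells and the set where the surplus vanishes cover the space, so [mu]
is dominated by the sum of its restrictions to them. *)
Let nu0_surplus :
  (\int[mu]_x (u x)%:E <= \sum_i \int[nu0 i]_x (u x)%:E)%E.
Proof.
have m0 := measurable_surplus0 mphi p.
pose out : {measure set T -> \bar R} := mrestr mu m0.
have out0 : (\int[out]_x (u x)%:E = 0)%E.
  apply: (integral_eq0_concentrated m0) => //; first exact: surplus_ge0.
  by rewrite /out /= /mrestr setICl measure0.
rewrite -integral_msum_extend_family//; last exact: surplus_ge0.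
rewrite -[leRHS]adde0 -out0 -ge0_integral_measure_add//; last 2 first.
- by move=> x _; rewrite lee_fin surplus_ge0.
- exact/measurable_EFinP.
apply: ge0_le_measure_integral => //.
- move=> A mA; apply: le_trans (le_measure_cells mphi mu p mA) _.
  apply: (@le_trans _ _ (msum (extend_family nu0) N A + out A)%E).
    by rewrite leeD2r// msum_extend_family.
  by rewrite -measure_addE.
- by move=> x; rewrite lee_fin surplus_ge0.
- exact/measurable_EFinP.
Qed.

Lemma total_profit_add_regret nu : (forall i, nu i [set: T] = (m i)%:E) ->
  (total_profit phi nu \is a fin_num) /\
  (total_profit phi nu + \sum_i \int[nu i]_x (regret i x)%:E
   = \sum_i \int[nu i]_x (u x)%:E + \sum_i (p i * m i)%:E)%E.
Proof.
move=> num; split.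
  by apply/sum_fin_numP => i _ _; exact: (profit_add_regret i (num i)).1.
rewrite /total_profit -!big_split/=; apply: eq_bigr => i _.
exact: (profit_add_regret i (num i)).2.
Qed.

(** Weak duality with its slack: each side is the collected surplus plus the
revenue [\sum_i p i * m i]. The revenue depends only on the masses, and the
cells, which have zero regret, collect the whole surplus. *)
Lemma total_profit_add_regret_le nu : weak_subpartition mu m nu ->
  (total_profit phi nu + \sum_i \int[nu i]_x (regret i x)%:E
   <= total_profit phi nu0)%E.
Proof.
move=> wnu; rewrite (total_profit_add_regret wnu.2).2.
have [_] := total_profit_add_regret weak_subpartition_cells.2.
rewrite [X in (_ + X)%E](_ : _ = 0%E) ?adde0; last by rewrite big1.
move=> ->; rewrite leeD2r//.
exact: le_trans (sum_integral_surplus_le wnu) nu0_surplus.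
Qed.

Let integral_regret_ge0 (nu : {measure set T -> \bar R}) i :
  (0 <= \int[nu]_x (regret i x)%:E)%E.
Proof. by apply: integral_ge0 => x _; rewrite lee_fin. Qed.

Lemma optimal_subpartition_cells : optimal_subpartition mu phi m nu0.
Proof.
split=> [|nu wnu]; first exact: weak_subpartition_cells.
apply: le_trans (total_profit_add_regret_le wnu).
by rewrite leeDl// sume_ge0.
Qed.

(** An optimum leaves no room for regret, and regret is positive off the
cell. *)
Lemma optimal_subpartition_unique nu :
  optimal_subpartition mu phi m nu -> eq_measures nu nu0.
Proof.
move=> [wnu onu] i.
have [fin_nu _] := total_profit_add_regret wnu.2.
have : (\sum_i \int[nu i]_x (regret i x)%:E <= 0)%E.
  rewrite -(leeD2lE _ _ fin_nu) adde0.
  exact: le_trans (total_profit_add_regret_le wnu) (onu _ weak_subpartition_cells).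
rewrite (bigD1 i)//= => sum_le0.
have regret0 : (\int[nu i]_x (regret i x)%:E = 0)%E.
  apply/eqP; rewrite eq_le integral_regret_ge0 andbT.
  by apply: le_trans sum_le0; rewrite leeDl// sume_ge0.
have nu_mu A : measurable A -> (nu i A <= mu A)%E.
  move=> mA; apply: le_trans (wnu.1 A mA); rewrite (bigD1 i)//=.
  by rewrite leeDl// sume_ge0.
apply: (eq_mrestr_concentrated (mcell i) nu_mu).
- apply: (concentrated_integral_eq0 (mcell i) _ _ _ regret0) => // x.
  by rewrite subr_gt0 ltNge => /negP.
- by rewrite wnu.2; exact/esym/cell_mass.
- by rewrite wnu.2 ltry.
Qed.

End duality.

(** * Continuous functions on a compact space *)

Lemma continuous_borel_measurable (R : realType) (X : ptopologicalType)
    (f : X -> R) :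
  continuous f -> measurable_fun [set: borel X] (f : borel X -> R).
Proof.
move=> /continuousP cf; apply: (measurability _ (RGenOpens.measurableE R)).
move=> _ [_ [a [b ->] <-]]; rewrite setTI.
by apply: sub_sigma_algebra; apply: cf; exact: interval_open.
Qed.

Lemma compact_continuous_bounded (R : realType) (X : topologicalType)
    (I : finType) (f : I -> X -> R) :
  compact [set: X] -> (forall i, continuous (f i)) ->
  exists M, forall i x, `|f i x| <= M.
Proof.
move=> cX cf.
have /choice[K fK] i : exists K, forall x, `|f i x| <= K.
  have : bounded_set (f i @` [set: X]).
    apply: compact_bounded; apply: continuous_compact => //.
    exact: continuous_subspaceT.
  move=> [K [_ fK]]; exists (K + 1) => x.
  by apply: (fK (K + 1)); [rewrite ltrDl|exists x].
exists (\big[Num.max/0]_i K i) => i x.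
by apply: le_trans (fK i x) _; exact: le_bigmax.
Qed.

Theorem corollary4p2 (R : realType) (X : ptopologicalType)
    (hcompact : compact [set: X]) (hpolish : polish R X)
    (mu : probability (borel X) R) (hmu : nonatomic mu)
    (N : nat) (phi : 'I_N -> X -> R) (hphi : forall i, continuous (phi i))
    (hdiff : forall i j, i != j -> forall r : R,
       mu [set x | phi i x - phi j x = r] = 0%E)
    (hlevel : forall i (r : R), mu [set x | phi i x = r] = 0%E)
    (m : 'I_N -> R) (hm0 : forall i, 0 <= m i) (hm1 : \sum_(i < N) m i < 1) :
  exists nu : 'I_N -> {measure set (borel X) -> \bar R},
    [/\ optimal_subpartition mu phi m nu,
        forall nu', optimal_subpartition mu phi m nu' -> eq_measures nu' nu
      & strong_subpartition mu m nu].
Proof.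
have mphi i := continuous_borel_measurable (hphi i).
have [M phiM] := compact_continuous_bounded hcompact hphi.
have [p cell_mass] := market_clearing mphi hdiff hlevel phiM hm0 hm1.
have disjoint i j := measure_cellI mphi hdiff p (i := i) (j := j).
exists (fun i => mrestr mu (measurable_cell mphi p i)); split.
- exact: (optimal_subpartition_cells mphi phiM disjoint cell_mass).
- exact: (optimal_subpartition_unique mphi phiM disjoint cell_mass).
- exact: (strong_subpartition_cells mphi disjoint cell_mass).
Qed.
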